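(* Let $G$ be a finite group. If $\mathscr{O}$ and $\mathscr{P}$ are operads in $\mathbf{Op}^G_+$, then $$A(\mathscr{O}\times\mathscr{P})=A(\mathscr{O})\wedge A(\mathscr{P}).$$ Consequently, the functor $\mathscr{O}\times(-):\mathbf{Op}^G_+\to\mathbf{Op}^G_+$ preserves weak equivalences for any operad $\mathscr{O}\in\mathbf{Op}^G_+$.
   Context: $G$ is a finite group. $\mathbf{Op}^G_+$ is the category of marked $G$-operads: symmetric operads $\mathscr{O}$ in left $G$-sets together with chosen elements $u\in\mathscr{O}(0)^G$ and $p\in\mathscr{O}(2)^G$; morphisms are operad maps preserving the markings. $\mathscr{O}(n)$ is regarded as a left $G\times\Sigma_n$-set via $(g,\sigma)\cdot x=gx\sigma^{-1}$. A graph subgroup of $G\times\Sigma_n$ is one of the form $\{(h,\sigma(h))\mid h\in H\}$ with $H\subset G$ a subgroup and $\sigma:H\to\Sigma_n$ a homomorphism; if $\sigma$ is a permutation representation of a finite $H$-set $T$ it is denoted $\Gamma(T)$. A morphism $\mathscr{O}\to\mathscr{P}$ in $\mathbf{Op}^G_+$ is a weak equivalence iff for all $n\ge0$ and graph subgroups $\Gamma\subset G\times\Sigma_n$, $\mathscr{P}(n)^\Gamma\neq\varnothing$ implies $\mathscr{O}(n)^\Gamma\ne\varnothing$. $A(\mathscr{O})$ is the class, graded over subgroups $H\subset G$, of all finite $H$-sets $T$ with $\mathscr{O}(|T|)^{\Gamma(T)}\ne\varnothing$. For $\mathscr{O}\in\mathbf{Op}^G_+$ it is a $G$-indexing system: a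 class $\mathcal{I}$ graded over the subgroups of $G$, with $\mathcal{I}(H)$ a class of finite $H$-sets, containing all finite trivial actions and closed under isomorphism, conjugation, restriction, subobjects, finite coproducts, and self-induction (if $T\in\mathcal{I}(K)$ and $H/K\in\mathcal{I}(H)$ then $H\times_KT\in\mathcal{I}(H)$). Indexing systems are ordered by inclusion, and $\wedge$ denotes meet (which is intersection). The product $\times$ is the categorical product in $\mathbf{Op}^G_+$. *)

(* Defs.v *)
From mathcomp Require Import all_boot all_order all_fingroup.
From mathcomp Require Import boolp.

Set Implicit Arguments.
Unset Strict Implicit.
Unset Printing Implicit Defensive.

(* Sigma_n is 'S_n with composition of functions as its product.  The product
   s * t of MathComp applies s first, hence the swap. *)
Definition perm_comp n (s t : 'S_n) : 'S_n := (t * s)%g.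

Lemma perm_compE n (s t : 'S_n) i : perm_comp s t i = s (t i).
Proof. by rewrite permM. Qed.

Section BlockPermutations.
Variables (k : nat) (j : 'I_k -> nat).

(* The block sum t_1 (+) ... (+) t_k, sending the r-th letter of block i to the
   (t_i r)-th letter of block i.  Letters of \sum_i j i are grouped in blocks of
   sizes j 0, j 1, ... by the lexicographic bijection tagnat. *)
Definition dsum_fun (t : forall i, 'S_(j i)) (x : 'I_(\sum_i j i)) :
    'I_(\sum_i j i) :=
  tagnat.Rank (tagnat.sig1 x) (t (tagnat.sig1 x) (tagnat.sig2 x)).

Lemma dsum_funE t i (r : 'I_(j i)) :
  dsum_fun t (tagnat.Rank i r) = tagnat.Rank i (t i r).
Proof.
rewrite /dsum_fun /tagnat.sig1 /tagnat.sig2 /tagnat.Rank.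
by rewrite tagnat.rankK.
Qed.

Lemma dsum_inj t : injective (dsum_fun t).
Proof.
move=> x y; rewrite -(tagnat.sigK x) -(tagnat.sigK y).
case: (tagnat.sig x) (tagnat.sig y) => [i r] [i' r'].
rewrite !tagnat.rankE !dsum_funE /= => /tagnat.rank_inj E.
have ii' : i = i' := congr1 tag E.
by case: _ / ii' r' E => r' /eqP; rewrite eq_Tagged /= => /eqP/perm_inj ->.
Qed.

Definition dsum_perm t : 'S_(\sum_i j i) := perm (@dsum_inj t).

Lemma sum_perm (s : 'S_k) : \sum_i j (s i) = \sum_i j i.
Proof. by rewrite [RHS](reindex_inj (@perm_inj _ s)). Qed.

(* The permutation of k blocks induced by s: blocks of sizes j (s 0), j (s 1),
   ... are moved to blocks of sizes j 0, j 1, ..., the r-th letter of the i-th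
   block going to the r-th letter of block s i. *)
Definition block_fun (s : 'S_k) (x : 'I_(\sum_i j i)) : 'I_(\sum_i j i) :=
  let y := cast_ord (esym (sum_perm s)) x in
  tagnat.Rank (s (tagnat.sig1 y)) (tagnat.sig2 y).

Lemma block_funE (s : 'S_k) i (r : 'I_(j (s i))) :
  block_fun s (cast_ord (sum_perm s) (tagnat.Rank i r)) = tagnat.Rank (s i) r.
Proof.
rewrite /block_fun cast_ordK /tagnat.sig1 /tagnat.sig2 /tagnat.Rank.
by rewrite tagnat.rankK.
Qed.

Lemma block_inj s : injective (block_fun s).
Proof.
move=> x y; rewrite -(cast_ordKV (sum_perm s) x) -(cast_ordKV (sum_perm s) y).
move: (cast_ord _ x) (cast_ord _ y) => {}x {}y.
rewrite -(tagnat.sigK x) -(tagnat.sigK y).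
case: (tagnat.sig x) (tagnat.sig y) => [i r] [i' r'].
rewrite !tagnat.rankE !block_funE /= => /tagnat.rank_inj E.
have ii' : i = i' := perm_inj (congr1 tag E).
by case: _ / ii' r' E => r' /eqP; rewrite eq_Tagged /= => /eqP ->.
Qed.

Definition block_perm s : 'S_(\sum_i j i) := perm (@block_inj s).

End BlockPermutations.

(* Symmetric operads in left G-sets, G being the whole group gT.  Equations
   between operations whose arities are equal but not convertible are stated in
   the total type {n & O n}. *)
Record operad (gT : finGroupType) := Operad {
  oper :> nat -> Type;
  gact : forall n, gT -> oper n -> oper n;
  ract : forall n, oper n -> 'S_n -> oper n;
  oid : oper 1;
  ocomp : forall k (j : 'I_k -> nat),
    oper k -> (forall i, oper (j i)) -> oper (\sum_(i < k) j i);
  gact1 : forall n (x : oper n), gact 1%g x = x;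
  gactM : forall n g h (x : oper n), gact (g * h)%g x = gact g (gact h x);
  ract1 : forall n (x : oper n), ract x 1%g = x;
  ractM : forall n (x : oper n) s t, ract x (perm_comp s t) = ract (ract x s) t;
  gact_ract : forall n g (x : oper n) s, gact g (ract x s) = ract (gact g x) s;
  gact_id : forall g, gact g oid = oid;
  gact_comp : forall g k (j : 'I_k -> nat) x (y : forall i, oper (j i)),
    gact g (ocomp x y) = ocomp (gact g x) (fun i => gact g (y i));
  ocomp1l : forall n (x : oper n),
    Tagged oper (ocomp oid (fun _ : 'I_1 => x)) = Tagged oper x;
  ocomp1r : forall n (x : oper n),
    Tagged oper (ocomp x (fun _ : 'I_n => oid)) = Tagged oper x;
  ocompA : forall k (j : 'I_k -> nat) (l : forall i, 'I_(j i) -> nat)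
      (x : oper k) (y : forall i, oper (j i)) (z : forall i r, oper (l i r)),
    Tagged oper (ocomp (ocomp x y)
                   (fun q => z (tagnat.sig1 q) (tagnat.sig2 q)))
    = Tagged oper (ocomp x (fun i => ocomp (y i) (z i)));
  ocomp_block : forall k (j : 'I_k -> nat) x (y : forall i, oper (j i)) s,
    Tagged oper (ocomp (ract x s) (fun i => y (s i)))
    = Tagged oper (ract (ocomp x y) (block_perm j s));
  ocomp_dsum : forall k (j : 'I_k -> nat) x (y : forall i, oper (j i))
      (t : forall i, 'S_(j i)),
    ocomp x (fun i => ract (y i) (t i)) = ract (ocomp x y) (dsum_perm t)
}.

Arguments oid {gT} o.

Record marked_operad (gT : finGroupType) := MarkedOperad {
  base_operad :> operad gT;
  mark0 : base_operad 0;
  mark2 : base_operad 2;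
  gact_mark0 : forall g, gact g mark0 = mark0;
  gact_mark2 : forall g, gact g mark2 = mark2
}.

Arguments mark0 {gT} m.
Arguments mark2 {gT} m.

Record morphism_of (gT : finGroupType) (O P : marked_operad gT) := MorphismOf {
  mor_fun :> forall n, O n -> P n;
  mor_gact : forall n g (x : O n), mor_fun (gact g x) = gact g (mor_fun x);
  mor_ract : forall n (x : O n) s, mor_fun (ract x s) = ract (mor_fun x) s;
  mor_id : mor_fun (oid O) = oid P;
  mor_comp : forall k (j : 'I_k -> nat) x (y : forall i, O (j i)),
    mor_fun (ocomp x y) = ocomp (mor_fun x) (fun i => mor_fun (y i));
  mor_mark0 : mor_fun (mark0 O) = mark0 P;
  mor_mark2 : mor_fun (mark2 O) = mark2 P
}.



#[local] Obligation Tactic := idtac.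

Section Product.
Variable gT : finGroupType.
Implicit Types O P Q : marked_operad gT.

Lemma Tagged_pair (A B : nat -> Type) m n (a : A m) (b : B m) (a' : A n)
    (b' : B n) :
  Tagged A a = Tagged A a' -> Tagged B b = Tagged B b' ->
  Tagged (fun i => A i * B i)%type (a, b)
  = Tagged (fun i => A i * B i)%type (a', b').
Proof.
move=> Ea Eb; have mn : m = n := congr1 tag Ea.
case: _ / mn in a' b' Ea Eb *.
by rewrite (eq_from_Tagged Ea) (eq_from_Tagged Eb).
Qed.

Program Definition prod_operad (O P : operad gT) : operad gT :=
  @Operad gT (fun n => O n * P n)%type
    (fun n g x => (gact g x.1, gact g x.2))
    (fun n x s => (ract x.1 s, ract x.2 s))
    (oid O, oid P)
    (fun k j x y => (ocomp x.1 (fun i => (y i).1), ocomp x.2 (fun i => (y i).2)))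
    _ _ _ _ _ _ _ _ _ _ _ _.
Next Obligation. by move=> O P n [x y] /=; rewrite !gact1. Qed.
Next Obligation. by move=> O P n g h x /=; rewrite !gactM. Qed.
Next Obligation. by move=> O P n [x y] /=; rewrite !ract1. Qed.
Next Obligation. by move=> O P n x s t /=; rewrite !ractM. Qed.
Next Obligation. by move=> O P n g x s /=; rewrite !gact_ract. Qed.
Next Obligation. by move=> O P g /=; rewrite !gact_id. Qed.
Next Obligation. by move=> O P g k j x y /=; rewrite !gact_comp. Qed.
Next Obligation.
by move=> O P n [x y] /=; apply: Tagged_pair; rewrite ocomp1l.
Qed.
Next Obligation.
by move=> O P n [x y] /=; apply: Tagged_pair; rewrite ocomp1r.
Qed.
Next Obligation.
move=> O P k j l x y z /=; apply: Tagged_pair.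
  exact: (@ocompA _ O _ _ _ x.1 (fun i => (y i).1) (fun i r => (z i r).1)).
exact: (@ocompA _ P _ _ _ x.2 (fun i => (y i).2) (fun i r => (z i r).2)).
Qed.
Next Obligation.
move=> O P k j x y s /=; apply: Tagged_pair.
  exact: (@ocomp_block _ O _ _ x.1 (fun i => (y i).1) s).
exact: (@ocomp_block _ P _ _ x.2 (fun i => (y i).2) s).
Qed.
Next Obligation. by move=> O P k j x y t /=; rewrite !ocomp_dsum. Qed.

Program Definition prod_marked O P : marked_operad gT :=
  @MarkedOperad gT (prod_operad O P)
    (mark0 O, mark0 P) (mark2 O, mark2 P) _ _.
Next Obligation. by move=> O P g /=; rewrite !gact_mark0. Qed.
Next Obligation. by move=> O P g /=; rewrite !gact_mark2. Qed.

Program Definition prod_fst O P : morphism_of (prod_marked O P) O :=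
  @MorphismOf gT (prod_marked O P) O (fun n x => x.1) _ _ _ _ _ _.
Solve All Obligations with by [].

Program Definition prod_snd O P : morphism_of (prod_marked O P) P :=
  @MorphismOf gT (prod_marked O P) P (fun n x => x.2) _ _ _ _ _ _.
Solve All Obligations with by [].

Program Definition pairing Q O P (a : morphism_of Q O) (b : morphism_of Q P) :
    morphism_of Q (prod_marked O P) :=
  @MorphismOf gT Q (prod_marked O P) (fun n x => (a n x, b n x)) _ _ _ _ _ _.
Next Obligation. by move=> Q O P a b n g x; rewrite /= !mor_gact. Qed.
Next Obligation. by move=> Q O P a b n x s; rewrite /= !mor_ract. Qed.
Next Obligation. by move=> Q O P a b; rewrite /= !mor_id. Qed.
Next Obligation. by move=> Q O P a b k j x y; rewrite /= !mor_comp. Qed.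
Next Obligation. by move=> Q O P a b; rewrite /= !mor_mark0. Qed.
Next Obligation. by move=> Q O P a b; rewrite /= !mor_mark2. Qed.

Program Definition comp_mor O P Q (b : morphism_of P Q) (a : morphism_of O P) :
    morphism_of O Q :=
  @MorphismOf gT O Q (fun n x => b n (a n x)) _ _ _ _ _ _.
Next Obligation. by move=> O P Q b a n g x; rewrite /= !mor_gact. Qed.
Next Obligation. by move=> O P Q b a n x s; rewrite /= !mor_ract. Qed.
Next Obligation. by move=> O P Q b a; rewrite /= !mor_id. Qed.
Next Obligation. by move=> O P Q b a k j x y; rewrite /= !mor_comp. Qed.
Next Obligation. by move=> O P Q b a; rewrite /= !mor_mark0. Qed.
Next Obligation. by move=> O P Q b a; rewrite /= !mor_mark2. Qed.

Definition id_mor O : morphism_of O O :=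
  @MorphismOf gT O O (fun _ x => x) (fun _ _ _ => erefl) (fun _ _ _ => erefl)
    erefl (fun _ _ _ _ => erefl) erefl erefl.

Lemma morphism_ext O P (a b : morphism_of O P) :
  (forall n (x : O n), a n x = b n x) -> a = b.
Proof.
case: a b => [a ? ? ? ? ? ?] [b ? ? ? ? ? ?] /= ab.
have {}ab : a = b by apply: functional_extensionality_dep => n; apply/funext.
by subst b; f_equal; apply: Prop_irrelevance.
Qed.

(* prod_marked is the categorical product. *)
Lemma prod_universal Q O P (a : morphism_of Q O) (b : morphism_of Q P) :
  exists! c : morphism_of Q (prod_marked O P),
    comp_mor (prod_fst O P) c = a /\ comp_mor (prod_snd O P) c = b.
Proof.
exists (pairing a b); split; first by split; apply: morphism_ext.
move=> c [<- <-]; apply: morphism_ext => n x /=.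
by case: (c n x).
Qed.

(* The functor O x (-) on morphisms. *)
Definition prod_map O P P' (f : morphism_of P P') :
    morphism_of (prod_marked O P) (prod_marked O P') :=
  pairing (prod_fst O P) (comp_mor f (prod_snd O P)).

Lemma prod_map_id O P : prod_map O (id_mor P) = id_mor (prod_marked O P).
Proof. by apply: morphism_ext => n [x y]. Qed.

Lemma prod_map_comp O P P' P'' (f : morphism_of P P') (g : morphism_of P' P'') :
  prod_map O (comp_mor g f) = comp_mor (prod_map O g) (prod_map O f).
Proof. exact: morphism_ext. Qed.

End Product.

(* A finite left H-set, acted upon by the subtype of elements of H. *)
Record Hset (gT : finGroupType) (H : {group gT}) := MkHset {
  carrier :> finType;
  hact : subg_of H -> carrier -> carrier;
  hact1 : forall a, hact 1%g a = a;
  hactM : forall g h a, hact (g * h)%g a = hact g (hact h a)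
}.

Section HsetConstructions.
Variable gT : finGroupType.
Implicit Types H K : {group gT}.

Lemma hactK H (T : Hset H) (h : subg_of H) :
  cancel (@hact _ _ T h) (hact h^-1%g).
Proof. by move=> a; rewrite -hactM mulVg hact1. Qed.

Lemma hact_inj H (T : Hset H) h : injective (@hact _ _ T h).
Proof. exact: can_inj (hactK h). Qed.

Definition equivariant H (S T : Hset H) (f : S -> T) :=
  forall h a, f (hact h a) = hact h (f a).

Definition iso_Hset H (S T : Hset H) :=
  exists2 f : S -> T, bijective f & equivariant f.

(* S is isomorphic to a sub-H-set of T. *)
Definition sub_Hset H (S T : Hset H) :=
  exists2 f : S -> T, injective f & equivariant f.

Definition triv_Hset H (T : finType) : Hset H :=
  @MkHset _ H T (fun _ a => a) (fun _ => erefl) (fun _ _ _ => erefl).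

Program Definition restr_Hset H K (sKH : K \subset H) (T : Hset H) : Hset K :=
  @MkHset _ K T (fun k a => hact (subg H (sgval k)) a) _ _.
Next Obligation.
by move=> H K sKH T a; rewrite -[RHS]hact1; congr hact; apply: val_inj;
  rewrite /= subgK.
Qed.
Next Obligation.
move=> H K sKH T g h a /=; rewrite -hactM; congr hact; apply: val_inj => /=.
by rewrite !subgK ?groupM // (subsetP sKH) ?subgP.
Qed.

(* The conjugate c_g T over g H g^-1, on which y acts as g^-1 y g.  In MathComp
   x ^ g is g^-1 * x * g, so g H g^-1 is H :^ g^-1. *)
Program Definition conj_Hset H (g : gT) (T : Hset H) : Hset (H :^ g^-1)%G :=
  @MkHset _ (H :^ g^-1)%G T (fun y a => hact (subg H (sgval y ^ g)%g) a) _ _.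
Next Obligation.
move=> H g T a /=; rewrite conj1g.
by rewrite -[RHS]hact1; congr hact; apply: val_inj; rewrite /= subgK.
Qed.
Next Obligation.
move=> H g T x y a /=; rewrite -hactM; congr hact; apply: val_inj => /=.
have yH (z : subg_of (H :^ g^-1)%G) : (sgval z ^ g)%g \in H.
  by have := subgP z; rewrite /= mem_conjgV.
have [xH' yH'] := (yH x, yH y).
by rewrite conjMg !subgK //; apply: groupM.
Qed.

Program Definition coprod_Hset H (J : finType) (X : J -> Hset H) : Hset H :=
  @MkHset _ H {j : J & X j}
    (fun h a => Tagged (fun j => X j) (hact h (tagged a))) _ _.
Next Obligation. by move=> H J X [j a]; rewrite hact1. Qed.
Next Obligation. by move=> H J X g h [j a]; rewrite hactM. Qed.

Lemma orbit_subproof H K (h : subg_of H) (A : {A | A \in lcosets K H}) :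
  (sgval h *: val A)%g \in lcosets K H.
Proof.
case: A => _ /= /lcosetsP[x xH ->]; apply/lcosetsP.
by exists (sgval h * x)%g; rewrite ?groupM ?subgP // -lcosetM.
Qed.

Program Definition orbit_Hset H K : Hset H :=
  @MkHset _ H {A | A \in lcosets K H}
    (fun h A => exist _ _ (orbit_subproof h A)) _ _.
Next Obligation. by move=> H K [A AP]; apply: val_inj; rewrite /= lcoset1. Qed.
Next Obligation. by move=> H K g h [A AP]; apply: val_inj; rewrite /= lcosetM. Qed.

(* H x_K T, the quotient of H x T by (h k, a) ~ (h, k a), realised as the set of
   equivalence classes.  This is meant for K \subset H. *)
Definition ind_class H K (T : Hset K) (u : subg_of H * T) :
    {set subg_of H * T} :=
  [set (u.1 * (subg H (sgval k))^-1, hact k u.2)%g | k : subg_of K].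

Definition ind_act H (T : finType) (h : subg_of H) (A : {set subg_of H * T}) :=
  [set (h * u.1, u.2)%g | u in A].

Lemma ind_act_class H K (T : Hset K) h (u : subg_of H * T) :
  ind_act h (ind_class u) = ind_class (h * u.1, u.2)%g.
Proof.
rewrite /ind_act /ind_class -imset_comp; apply: eq_imset => k /=.
by rewrite mulgA.
Qed.

Lemma ind_subproof H K (T : Hset K) (h : subg_of H)
    (A : {A | A \in [set ind_class u | u : subg_of H * T]}) :
  ind_act h (val A) \in [set ind_class u | u : subg_of H * T].
Proof.
by case: A => _ /= /imsetP[u _ ->]; rewrite ind_act_class imset_f.
Qed.

Program Definition ind_Hset H K (T : Hset K) : Hset H :=
  @MkHset _ H {A | A \in [set ind_class u | u : subg_of H * T]}
    (fun h A => exist _ _ (ind_subproof h A)) _ _.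
Next Obligation.
move=> H K T [A AP]; apply: val_inj => /=; have /imsetP[[h a] _ ->] := AP.
by rewrite ind_act_class /= mul1g.
Qed.
Next Obligation.
move=> H K T g h [A AP]; apply: val_inj => /=.
have /imsetP[[h' a] _ ->] := AP.
by rewrite !ind_act_class /= mulgA.
Qed.

End HsetConstructions.

Arguments ind_Hset {gT} H {K} T.

Record indexing_system (gT : finGroupType) := IndexingSystem {
  isys :> forall H : {group gT}, Hset H -> Prop;
  isys_triv : forall (H : {group gT}) (T : finType), isys (triv_Hset H T);
  isys_iso : forall (H : {group gT}) (S T : Hset H),
    iso_Hset S T -> isys S -> isys T;
  isys_conj : forall (H : {group gT}) g (T : Hset H),
    isys T -> isys (conj_Hset g T);
  isys_restr : forall (H K : {group gT}) (sKH : K \subset H) (T : Hset H),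
    isys T -> isys (restr_Hset sKH T);
  isys_sub : forall (H : {group gT}) (S T : Hset H),
    sub_Hset S T -> isys T -> isys S;
  isys_coprod : forall (H : {group gT}) (J : finType) (X : J -> Hset H),
    (forall j, isys (X j)) -> isys (coprod_Hset X);
  isys_ind : forall (H K : {group gT}) (T : Hset K), K \subset H ->
    isys T -> isys (orbit_Hset H K) -> isys (ind_Hset H T)
}.

Definition isys_le (gT : finGroupType) (I J : indexing_system gT) :=
  forall (H : {group gT}) (T : Hset H), I H T -> J H T.

Lemma isys_ext (gT : finGroupType) (I J : indexing_system gT) :
  (forall (H : {group gT}) (T : Hset H), I H T <-> J H T) -> I = J.
Proof.
case: I J => [I ? ? ? ? ? ? ?] [J ? ? ? ? ? ? ?] /= IJ.
have {}IJ : I = J.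
  by apply: functional_extensionality_dep => H; apply/funext => T; apply/propext.
by subst J; f_equal; apply: Prop_irrelevance.
Qed.

Program Definition isys_meet (gT : finGroupType) (I J : indexing_system gT) :
    indexing_system gT :=
  @IndexingSystem gT (fun H T => I H T /\ J H T) _ _ _ _ _ _ _.
Next Obligation. by move=> gT I J H T; split; apply: isys_triv. Qed.
Next Obligation.
by move=> gT I J H S T ST [? ?]; split; apply: isys_iso ST _.
Qed.
Next Obligation. by move=> gT I J H g T [? ?]; split; apply: isys_conj. Qed.
Next Obligation.
by move=> gT I J H K sKH T [? ?]; split; apply: isys_restr.
Qed.
Next Obligation.
by move=> gT I J H S T ST [? ?]; split; apply: isys_sub ST _.
Qed.
Next Obligation.
by move=> gT I J H L X IX; split; apply: isys_coprod => j; case: (IX j).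
Qed.
Next Obligation.
by move=> gT I J H K T sKH [? ?] [? ?]; split; apply: isys_ind.
Qed.

Lemma isys_meetP (gT : finGroupType) (I J L : indexing_system gT) :
  isys_le L (isys_meet I J) <-> isys_le L I /\ isys_le L J.
Proof.
split=> [LIJ | [LI LJ] H T LT]; last by split; [apply: LI | apply: LJ].
by split=> H T /LIJ[].
Qed.

Section FixedPoints.
Variable gT : finGroupType.
Implicit Types (H K : {group gT}) (O P : marked_operad gT).

(* Gamma = {(h, s h) | h in H} for a homomorphism s : H -> Sigma_n. *)
Definition graph_subgroup n (Gamma : {set gT * 'S_n}) :=
  exists H (s : subg_of H -> 'S_n),
    (forall g h, s (g * h)%g = perm_comp (s g) (s h))
    /\ Gamma = [set (sgval h, s h) | h : subg_of H].

(* The left action (g, s) x = g x s^-1 of G x Sigma_n on O n. *)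
Definition gsact O n (a : gT * 'S_n) (x : O n) : O n :=
  gact a.1 (ract x a.2^-1%g).

Definition has_fixed O n (Gamma : {set gT * 'S_n}) :=
  exists x : O n, forall a, a \in Gamma -> gsact a x = x.

Definition weak_equivalence O P (f : morphism_of O P) :=
  forall n (Gamma : {set gT * 'S_n}), graph_subgroup Gamma ->
    has_fixed P Gamma -> has_fixed O Gamma.

(* The permutation representation of T in its canonical enumeration, and the
   graph subgroup Gamma(T).  Another enumeration gives a conjugate subgroup. *)
Definition rep_fun H (T : Hset H) h (i : 'I_#|T|) : 'I_#|T| :=
  enum_rank (hact h (enum_val i)).

Lemma rep_inj H (T : Hset H) h : injective (@rep_fun H T h).
Proof.
by move=> i i' /enum_rank_inj/hact_inj/enum_val_inj.
Qed.

Definition perm_rep H (T : Hset H) h : 'S_#|T| := perm (@rep_inj H T h).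

Definition Gam H (T : Hset H) : {set gT * 'S_#|T|} :=
  [set (sgval h, perm_rep T h) | h : subg_of H].

Lemma Gam_graph H (T : Hset H) : graph_subgroup (Gam T).
Proof.
exists H, (perm_rep T); split=> // g h; apply/permP => i.
by rewrite perm_compE !permE /rep_fun enum_rankK hactM.
Qed.

Definition admissible O H (T : Hset H) := has_fixed O (Gam T).

End FixedPoints.

Section Admissible.
Variable gT : finGroupType.
Implicit Types (H K : {group gT}) (O : marked_operad gT).

Lemma admissibleP O H (T : Hset H) :
  admissible O T <->
  exists x : O #|T|, forall h, gact (sgval h) x = ract x (perm_rep T h).
Proof.
split=> -[x Hx].
  exists x => h.
  have /Hx : (sgval h, perm_rep T h) \in Gam T by apply/imsetP; exists h.
  rewrite /gsact /= => E; rewrite -[in RHS]E gact_ract -ractM.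
  by rewrite /perm_comp mulgV ract1.
exists x => _ /imsetP[h _ ->].
by rewrite /gsact /= gact_ract Hx -ractM /perm_comp mulVg ract1.
Qed.

(* The choice of an enumeration is immaterial. *)
Lemma admissible_enum O H (T : Hset H) n (f : T -> 'I_n) (x : O n)
    (s : subg_of H -> 'S_n) :
  bijective f -> (forall h a, f (hact h a) = s h (f a)) ->
  (forall h, gact (sgval h) x = ract x (s h)) -> admissible O T.
Proof.
move=> f_bij fE xE; apply/admissibleP.
have nE : #|T| = n by rewrite (bij_eq_card f_bij) card_ord.
subst n.
have p_inj : injective (fun i : 'I_#|T| => f (enum_val i)).
  by move=> i i' E; apply: enum_val_inj; apply: (bij_inj f_bij).
exists (ract x (perm p_inj)) => h.
rewrite gact_ract xE -!ractM; congr ract; apply/permP => i.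
by rewrite !perm_compE !permE -fE /rep_fun enum_rankK.
Qed.

Lemma ocomp_ext O k (j j' : 'I_k -> nat) (x : O k) (y : forall i, O (j i))
    (y' : forall i, O (j' i)) :
  (forall i, Tagged O (y i) = Tagged O (y' i)) ->
  Tagged O (ocomp x y) = Tagged O (ocomp x y').
Proof.
move=> yy'; have jj' : j = j' by apply/funext => i; apply: (congr1 tag (yy' i)).
subst j'; congr (Tagged O (ocomp x _)).
by apply: functional_extensionality_dep => i; apply: eq_from_Tagged.
Qed.

Lemma admissible_comp O H (T : Hset H) n (s : subg_of H -> 'S_n) (x : O n)
    (j : 'I_n -> nat) (y : forall i, O (j i)) (t : subg_of H -> forall i, 'S_(j i))
    (z : subg_of H -> forall i, O (j i)) (f : forall i, 'I_(j i) -> T) :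
  (forall h, gact (sgval h) x = ract x (s h)) ->
  (forall h i, Tagged O (y (s h i)) = Tagged O (z h i)) ->
  (forall h i, gact (sgval h) (y i) = ract (z h i) (t h i)) ->
  (forall i r i' r', f i r = f i' r' -> i = i' /\ r = r' :> nat) ->
  (forall a, exists i r, f i r = a) ->
  (forall h i r (r' : 'I_(j (s h i))), r' = t h i r :> nat ->
     hact h (f i r) = f (s h i) r') ->
  admissible O T.
Proof.
move=> xE yz yE f_inj f_surj fE.
pose b h := perm_comp (block_perm j (s h)) (dsum_perm (t h)).
pose F q := f (tagnat.sig1 q) (tagnat.sig2 q).
have FE i r : F (tagnat.Rank i r) = f i r.
  by rewrite /F /tagnat.sig1 /tagnat.sig2 /tagnat.Rank tagnat.rankK.
have F_surj a : exists q, F q = a.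
  by have [i [r <-]] := f_surj a; exists (tagnat.Rank i r); rewrite FE.
pose G a := projT1 (cid (F_surj a)).
have GK : cancel G F by move=> a; rewrite /G; case: cid.
have FK : cancel F G.
  apply: inj_can_sym GK _ => q q' /f_inj[q1 q2]; apply: val_inj => /=.
  apply/eqP; rewrite -(tagnat.sig2K q) -(tagnat.sig2K q') tagnat.eq_Rank.
  by apply/andP; split; apply/eqP.
apply: (@admissible_enum O H T _ G (ocomp x y) b).
- by exists F.
- move=> h a; apply: (can_inj FK); rewrite GK -{1}(GK a).
  move: (G a) => q; rewrite -(tagnat.sig2K q).
  move: (tagnat.sig1 q) (tagnat.sig2 q) => i r.
  have jE i' : j (s h i') = j i' := congr1 tag (yz h i').
  rewrite FE /b perm_compE !permE dsum_funE.
  rewrite (fE h i r (cast_ord (esym (jE i)) (t h i r))) //.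
  rewrite (_ : tagnat.Rank i _ = cast_ord (sum_perm j (s h))
      (tagnat.Rank (p_ := fun i => j (s h i)) i
         (cast_ord (esym (jE i)) (t h i r)))); last first.
    apply: val_inj; rewrite [LHS]tagnat.RankEsum [RHS]tagnat.RankEsum /=; congr (_ + _).
    by apply: eq_bigr => i' _.
  by rewrite block_funE FE.
- move=> h; rewrite gact_comp xE ractM.
  rewrite (_ : (fun i => _) = (fun i => ract (z h i) (t h i))); last first.
    by apply: functional_extensionality_dep => i; apply: yE.
  rewrite ocomp_dsum; congr ract; apply: (@eq_from_Tagged _ O).
  by rewrite -ocomp_block; apply: ocomp_ext => i; rewrite yz.
Qed.

Lemma fixed_point O n : exists x : O n, forall g, gact g x = x.
Proof.
elim: n => [|n [x xE]]; first by exists (mark0 O); apply: gact_mark0.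
pose jb (b : bool) := if b then n else 1.
pose yb b : O (jb b) := if b as b return O (jb b) then x else oid O.
pose j (i : 'I_2) := jb (i == ord0).
have jE : \sum_i j i = n.+1.
  by rewrite !big_ord_recl big_ord0 /j /= addn0 addn1.
rewrite -jE; exists (ocomp (mark2 O) (fun i : 'I_2 => yb (i == ord0))) => g.
rewrite gact_comp gact_mark2; congr ocomp.
apply: functional_extensionality_dep => i.
by rewrite /j; case: (i == ord0); rewrite /= ?xE ?gact_id.
Qed.

Lemma admissible_triv O H (T : finType) : admissible O (triv_Hset H T).
Proof.
have [x xE] := fixed_point O #|T|.
apply: (@admissible_enum O H (triv_Hset H T) _ (@enum_rank T) x (fun=> 1%g)).
- exact: enum_rank_bij.
- by move=> h a; rewrite perm1.
- by move=> h; rewrite xE ract1.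
Qed.

Lemma admissible_iso O H (S T : Hset H) :
  iso_Hset S T -> admissible O S -> admissible O T.
Proof.
case=> f [g fK gK] fE /admissibleP[x xE].
apply: (@admissible_enum O H T _ (enum_rank \o g) x (perm_rep S)) => //.
- exact: bij_comp (@enum_rank_bij _) (Bijective gK fK).
- move=> h a; rewrite permE /rep_fun /= enum_rankK; congr enum_rank.
  by rewrite -{1}(gK a) -fE fK.
Qed.

Lemma admissible_conj O H g (T : Hset H) :
  admissible O T -> admissible O (conj_Hset g T).
Proof.
move=> /admissibleP[x xE].
apply: (@admissible_enum O _ (conj_Hset g T) _ (@enum_rank T) (gact g x)
          (fun y => perm_rep T (subg H (sgval y ^ g)%g))).
- exact: enum_rank_bij.
- by move=> y a; rewrite permE /rep_fun enum_rankK.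
- move=> y; rewrite -gactM -gact_ract -xE -gactM; congr gact.
  have yH : (sgval y ^ g)%g \in H.
    by have := subgP y; rewrite /= mem_conjgV.
  by rewrite subgK // conjgE !mulgA mulgV mul1g.
Qed.

Lemma admissible_restr O H K (sKH : K \subset H) (T : Hset H) :
  admissible O T -> admissible O (restr_Hset sKH T).
Proof.
move=> /admissibleP[x xE].
apply: (@admissible_enum O _ (restr_Hset sKH T) _ (@enum_rank T) x
          (fun k => perm_rep T (subg H (sgval k)))).
- exact: enum_rank_bij.
- by move=> y a; rewrite permE /rep_fun enum_rankK.
- by move=> k; rewrite -xE subgK // (subsetP sKH) ?subgP.
Qed.

Lemma admissible_sub O H (S T : Hset H) :
  sub_Hset S T -> admissible O T -> admissible O S.
Proof.
case=> f f_inj fE /admissibleP[x xE].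
pose c (i : 'I_#|T|) := enum_val i \in codom f.
pose j i : nat := c i.
pose yb (b : bool) : O b := if b as b return O b then oid O else mark0 O.
pose y i : O (j i) := yb (c i).
have cE h i : c (perm_rep T h i) = c i.
  rewrite /c permE /rep_fun enum_rankK; apply/codomP/codomP => -[a aE].
    by exists (hact h^-1%g a); rewrite fE -aE hactK.
  by exists (hact h a); rewrite fE aE.
have cP i : 'I_(j i) -> c i by rewrite /j; case: (c i) => // -[].
have j0 i (r : 'I_(j i)) : r = 0 :> nat.
  by case: r; rewrite /j; case: (c i) => // -[].
apply: (@admissible_comp O H S _ (perm_rep T) x j y (fun _ _ => 1%g)
  (fun _ => y) (fun i r => iinv (cP i r))) => //.
- by move=> h i; rewrite /y /j cE.
- by move=> h i; rewrite ract1 /y /j; case: (c i); rewrite ?gact_id ?gact_mark0.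
- move=> i r i' r' /(congr1 f); rewrite !f_iinv => /enum_val_inj ii'.
  by split=> //; rewrite !j0.
- move=> a; exists (enum_rank (f a)).
  have fa : 0 < j (enum_rank (f a)) by rewrite /j /c enum_rankK codom_f.
  by exists (Ordinal fa); apply: f_inj; rewrite f_iinv enum_rankK.
- move=> h i r r' _; apply: f_inj.
  by rewrite fE !f_iinv permE /rep_fun enum_rankK.
Qed.

Lemma admissible_coprod O H (J : finType) (X : J -> Hset H) :
  (forall j, admissible O (X j)) -> admissible O (coprod_Hset X).
Proof.
move=> XE; have [x xE] := fixed_point O #|J|.
have YE j := cid ((admissibleP O (X j)).1 (XE j)).
pose Z (i : 'I_#|J|) := X (enum_val i).
apply: (@admissible_comp O H (coprod_Hset X) _ (fun=> 1%g) x (fun i => #|Z i|)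
  (fun i => projT1 (YE (enum_val i))) (fun h i => perm_rep (Z i) h)
  (fun _ i => projT1 (YE (enum_val i)))
  (fun i r => Tagged (fun k => X k) (enum_val r : Z i))) => //.
- by move=> h; rewrite xE ract1.
- by move=> h i; rewrite perm1.
- by move=> h i; apply: (projT2 (YE (enum_val i))).
- move=> i r i' r' E; have ii' : i = i' := enum_val_inj (congr1 tag E).
  case: _ / ii' in r' E *; split=> //.
  by have /enum_val_inj -> := eq_from_Tagged E.
- case=> k a; have kE := enum_rankK k; move: (enum_rank k) kE => i kE.
  by subst k; exists i, (enum_rank (a : Z i)); rewrite (enum_rankK (a : Z i)).
- move=> h i r; move: (fun_of_perm 1%g i) (perm1 i) => i' ii' r'.
  case: _ / (esym ii') in r' * => /val_inj ->.
  by rewrite permE /rep_fun enum_rankK.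
Qed.

Lemma admissible_ind O H K (T : Hset K) : K \subset H ->
  admissible O T -> admissible O (orbit_Hset H K) -> admissible O (ind_Hset H T).
Proof.
move=> sKH /admissibleP[y yE] /admissibleP[x xE].
set Q := orbit_Hset H K in x xE.
pose inc (k : subg_of K) := subg H (sgval k).
have incE k : sgval (inc k) = sgval k.
  by rewrite subgK // (subsetP sKH) ?subgP.
have incM k l : inc (k * l)%g = (inc k * inc l)%g.
  by apply: val_inj; rewrite /= !incE.
(* coset representatives *)
have repP (A : Q) : exists h : subg_of H, val A = (sgval h *: K)%g.
  by case: A => _ /= /lcosetsP[h hH ->]; exists (subg H h); rewrite subgK.
pose rep (i : 'I_#|Q|) := projT1 (cid (repP (enum_val i))).
have repE i : val (enum_val i) = (sgval (rep i) *: K)%g.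
  by rewrite /rep; case: cid.
(* h (rep i) = rep (h i) k *)
have kP h i : exists k : subg_of K, (h * rep i = rep (perm_rep Q h i) * inc k)%g.
  have : (sgval (h * rep i) \in sgval (rep (perm_rep Q h i)) *: K)%g.
    rewrite -repE permE /rep_fun enum_rankK /= repE -lcosetM lcoset_refl //.
  case/lcosetP => k kK E; exists (subg K k); apply: val_inj => /=.
  by rewrite incE subgK // -E.
pose kk h i := projT1 (cid (kP h i)).
have kkE h i : (h * rep i = rep (perm_rep Q h i) * inc (kk h i))%g.
  by rewrite /kk; case: cid.
have cP (u : subg_of H * T) :
  ind_class u \in [set ind_class u | u : subg_of H * T] by apply: imset_f.
have classE (g : subg_of H) k a :
  ind_class ((g * inc k)%g, a) = ind_class (g, hact k a) :> {set subg_of H * T}.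
  have incV l : inc l^-1%g = (inc l)^-1%g by apply: val_inj; rewrite /= !incE.
  apply/setP => v; apply/imsetP/imsetP => -[l _ ->].
    exists (l * k^-1)%g => //; rewrite -![subg H _]/(inc _) incM incV.
    by rewrite invMg invgK /= hactM hactK mulgA.
  exists (l * k)%g => //; rewrite -![subg H _]/(inc _) incM invMg /= hactM.
  by rewrite !mulgA mulgK.
pose f (i : 'I_#|Q|) (r : 'I_#|T|) : ind_Hset H T :=
  @exist _ (fun A => A \in [set ind_class u | u : subg_of H * T]) _
    (cP (rep i, enum_val r)).
apply: (@admissible_comp O H (ind_Hset H T) _ (perm_rep Q) x (fun=> #|T|)
  (fun i => gact (sgval (rep i)) y) (fun h i => perm_rep T (kk h i))
  (fun h i => gact (sgval (rep (perm_rep Q h i))) y)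
  f) => //.
- move=> h i; rewrite -gactM -gact_ract -yE -gactM.
  by rewrite -[LHS]/(gact (sgval (h * rep i)%g) y) kkE /= incE.
- move=> i r i' r' /(congr1 val) /= E.
  have : (rep i, enum_val r) \in ind_class (rep i', enum_val r').
    rewrite -E; apply/imsetP; exists 1%g => //=.
    rewrite hact1 (_ : subg H _ = 1%g) ?invg1 ?mulg1 //.
    by apply: val_inj; rewrite /= subgK.
  case/imsetP => k _ [] /= ri ra.
  have ii' : i = i'.
    apply/enum_val_inj/val_inj; rewrite !repE ri /=.
    by rewrite -/(inc k) incE lcosetM lcoset_id // groupV subgP.
  subst i'; split=> //.
  have k1 : inc k = 1%g.
    by apply: invg_inj; apply: (mulgI (rep i)); rewrite invg1 mulg1.
  have {}k1 : k = 1%g by apply: val_inj; rewrite [LHS](esym (incE k)) k1.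
  by move: ra; rewrite k1 hact1 => /enum_val_inj ->.
- case=> A AP; have /imsetP[[g a] _ AE] := AP.
  have gP : ((sgval g *: K)%g \in lcosets K H).
    by apply/lcosetsP; exists (sgval g); rewrite ?subgP.
  pose i := enum_rank (@exist _ (fun A => A \in lcosets K H) _ gP : Q).
  have [k gE] : exists k, g = (rep i * inc k)%g.
    have : sgval g \in (sgval (rep i) *: K)%g.
      by rewrite -repE enum_rankK /= lcoset_refl.
    case/lcosetP => k kK E; exists (subg K k); apply: val_inj => /=.
    by rewrite incE subgK // -E.
  exists i, (enum_rank (hact k a)); apply: val_inj.
  by rewrite /f /= AE {1}gE classE (enum_rankK (hact k a)).
- move=> h i r r' rE; apply: val_inj => /=; rewrite ind_act_class /= kkE classE.
  have -> : r' = perm_rep T (kk h i) r by apply: val_inj.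
  by rewrite [perm_rep T _ _]permE /rep_fun enum_rankK.
Qed.

Definition adm O : indexing_system gT :=
  @IndexingSystem gT (@admissible gT O) (admissible_triv O) (@admissible_iso O)
    (@admissible_conj O) (@admissible_restr O) (@admissible_sub O)
    (@admissible_coprod O) (@admissible_ind O).

End Admissible.

(* Main.v *)
Require Import Defs.
From mathcomp Require Import all_boot all_order all_fingroup.

(* Fixed points of a product are pairs of fixed points; this gives both claims,
   the second by keeping the component in O and transferring the other along f. *)
Lemma has_fixed_prod (gT : finGroupType) (O P : marked_operad gT) n
    (Gamma : {set gT * 'S_n}) :
  has_fixed (prod_marked O P) Gamma <-> has_fixed O Gamma /\ has_fixed P Gamma.
Proof.
split=> [[[x y] xyE] | [[x xE] [y yE]]].
  (* [gsact] on the product computes componentwise, so each fixed-point equation is an equality of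
     pairs. *)
  by split; [exists x | exists y] => a /xyE[].
by exists (x, y) => a aG; congr pair; [apply: xE | apply: yE].
Qed.

Theorem proposition4p10 (gT : finGroupType) :
  (forall O P : marked_operad gT,
     adm (prod_marked O P) = isys_meet (adm O) (adm P))
  /\ (forall (O P P' : marked_operad gT) (f : morphism_of P P'),
        weak_equivalence f -> weak_equivalence (prod_map O f)).
Proof.
split=> [O P | O P P' f f_weq n Gamma Gamma_graph].
  (* By conversion, membership of [T] in [adm] is [has_fixed] at [Gam T], and the meet is a
     conjunction. *)
  by apply: isys_ext => H T; apply: has_fixed_prod.
(* Only existence is pulled back, from [P'] to [P]: the fixed point obtained in [P] need not map to
   the given one under [f]. *)
move=> /has_fixed_prod[xO /(f_weq _ _ Gamma_graph) xP].
exact/has_fixed_prod.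
Qed.
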